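(* Let $\mathbb{H}\in\mathbb{R}_+^{n_R\times n_T}$ be an entrywise nonnegative matrix of rank $r\ge 1$ with columns $\mathbf{h}_1,\dots,\mathbf{h}_{n_T}$ and nonzero singular values $\sigma_1\ge\sigma_2\ge\cdots\ge\sigma_r>0$, and let $\mathbf{v}_1,\dots,\mathbf{v}_r$ be orthonormal vectors in $\mathbb{R}^{n_T}$ with $\mathbb{H}^{\mathsf T}\mathbb{H}\mathbf{v}_i=\sigma_i^2\mathbf{v}_i$ for $i=1,\dots,r$. If the channel graph of $\mathbb{H}$ is strongly connected, then the entries of $\mathbf{v}_1$ are either all (strictly) positive or all (strictly) negative, and $\sigma_1>\sigma_i$ for every $i\in\{2,\dots,r\}$.
   Context: The channel graph of $\mathbb{H}$ is the directed graph with vertex set $\{P_1,\dots,P_{n_T}\}$ and edge set $\{(P_i,P_j): \mathbf{h}_i^{\mathsf T}\mathbf{h}_j\neq 0\}$. It is strongly connected if there is no nonempty proper subset $\mathcal{U}\subsetneq\{1,\dots,n_T\}$ such that $\mathbb{H}_{\mathcal{U}^c}^{\mathsf T}\mathbb{H}_{\mathcal{U}}=\mathbf{0}$, where $\mathbb{H}_{\mathcal{J}}$ denotes the submatrix formed by the columns of $\mathbb{H}$ indexed by $\mathcal{J}$. *)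

(* Defs.v *)
From mathcomp Require Import all_boot all_order all_algebra.
From mathcomp Require Import reals.

Set Implicit Arguments.
Unset Strict Implicit.
Unset Printing Implicit Defensive.

Import Order.TTheory GRing.Theory Num.Theory.

Local Open Scope ring_scope.

Definition cols_mx (R : realType) (m n : nat) (H : 'M[R]_(m, n))
    (J : {set 'I_n}) : 'M[R]_(m, #|J|) :=
  colsub (@enum_val _ (mem J)) H.

Definition channel_graph (R : realType) (m n : nat) (H : 'M[R]_(m, n)) :
    rel 'I_n :=
  fun i j => (col i H)^T *m col j H != 0.

(* The product vanishes exactly when no edge of channel_graph H goes from ~: U
   to U; channel_strongly_connectedP relates this to paths in the graph. *)
Definition channel_strongly_connected (R : realType) (m n : nat)
    (H : 'M[R]_(m, n)) : Prop :=
  ~ exists U : {set 'I_n},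
      [/\ U != set0, U \proper [set: 'I_n]
        & (cols_mx H (~: U))^T *m cols_mx H U = 0].

(* The singular values of H are the nonnegative square roots of the eigenvalues
   of H^T H, counted with multiplicity; s lists the nonzero ones in
   nonincreasing order, and the eigenvalue 0 has the remaining multiplicity
   n - r. *)
Definition nonzero_singular_values (R : realType) (m n r : nat)
    (H : 'M[R]_(m, n)) (s : 'I_r -> R) : Prop :=
  [/\ forall i, 0 < s i,
      forall i j : 'I_r, (i <= j)%N -> s j <= s i
    & char_poly (H^T *m H) =
        'X^(n - r) * \prod_(i < r) ('X - (s i ^+ 2)%:P)].

Lemma channel_strongly_connectedP (R : realType) (m n : nat)
    (H : 'M[R]_(m, n)) :
  channel_strongly_connected H <->
  (forall i j : 'I_n, connect (channel_graph H) i j).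
Proof.
have entE i j : (col i H)^T *m col j H = ((H^T *m H) i j)%:M.
  by apply/rowP=> k; rewrite !ord1 !mxE eqxx mulr1n; apply: eq_bigr => l _; rewrite !mxE.
have edgeE i j : channel_graph H i j = ((H^T *m H) i j != 0).
  rewrite /channel_graph entE; congr (~~ _).
  apply/eqP/eqP => [/matrixP/(_ 0 0)|->]; first by rewrite !mxE eqxx mulr1n.
  by apply/matrixP=> a b; rewrite !mxE ?mul0rn.
have blockE (U : {set 'I_n}) : (cols_mx H (~: U))^T *m cols_mx H U = 0 <->
    (forall i j, i \notin U -> j \in U -> ~~ channel_graph H i j).
  split=> [/matrixP E i j iU jU|E].
    have iC : i \in ~: U by rewrite inE.
    rewrite edgeE negbK; apply/eqP.
    have := E (enum_rank_in iC i) (enum_rank_in jU j).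
    rewrite !mxE; apply: etrans; apply: eq_bigr => k _.
    by rewrite !mxE !enum_rankK_in.
  apply/matrixP => a b.
  have aU : enum_val a \notin U by have := enum_valP a; rewrite inE.
  have := E _ _ aU (enum_valP b); rewrite edgeE negbK => /eqP.
  by rewrite !mxE; apply: etrans; apply: eq_bigr => k _; rewrite !mxE.
split=> [C i j|C [U [/set0Pn[j jU] /properP[_ [i _ iU]] /blockE E]]].
  apply/negPn/negP => nij; apply: C.
  exists [set k | ~~ connect (channel_graph H) i k]; split.
  - by apply/set0Pn; exists j; rewrite inE.
  - by apply/properP; split; [exact: subsetT | exists i; rewrite ?inE ?connect0].
  apply/blockE => a b; rewrite !inE negbK => ia; apply: contra => ab.
  exact: connect_trans ia (connect1 ab).
have cl : closed (channel_graph H) (mem U).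
  move=> a b ab; have sym x y : channel_graph H x y = channel_graph H y x.
    by rewrite !edgeE -[in LHS](trmxK (H^T *m H)) trmx_mul trmxK mxE.
  apply/idP/idP => h; apply/negPn/negP => h'.
    by have := E _ _ h' h; rewrite sym ab.
  by have := E _ _ h' h; rewrite ab.
by have := closed_connect cl (C i j); rewrite [RHS]jU (negPf iU).
Qed.

(* Main.v *)
(** By the rank hypothesis the rows of [H] lie in the span of the [v i], so
    [H^T H = V^T D V] with [V] the matrix of rows [(v i)^T], and
    [sigma_1^2 - H^T H] is the square of a symmetric matrix.  Hence every vector
    whose Rayleigh quotient reaches [sigma_1^2] is an eigenvector; this applies to
    [|u|] for every eigenvector [u] for [sigma_1^2].  A nonnegative nonzero
    eigenvector is positive by connectedness; applied to [|u| + u] this shows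
    that [u] has a constant strict sign, and two such vectors are never
    orthogonal. *)
Require Import Defs.
From mathcomp Require Import all_boot all_order all_algebra.
From mathcomp Require Import reals.

Set Implicit Arguments.
Unset Strict Implicit.
Unset Printing Implicit Defensive.

Import Order.TTheory GRing.Theory Num.Theory.

Local Open Scope ring_scope.

Lemma trmx_mul_self_eq0 (R : realDomainType) (n : nat) (y : 'cV[R]_n) :
  (y^T *m y) 0 0 <= 0 -> y = 0.
Proof.
have sq_ge0 k : true -> 0 <= y k 0 ^+ 2 by rewrite sqr_ge0.
have -> : (y^T *m y) 0 0 = \sum_k y k 0 ^+ 2.
  by rewrite mxE; apply: eq_bigr => k _; rewrite mxE expr2.
move=> le0; apply/colP => k; rewrite [RHS]mxE; apply/eqP.
have /eqP : \sum_k y k 0 ^+ 2 == 0 by rewrite eq_le le0 sumr_ge0.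
by move/(psumr_eq0P sq_ge0)/(_ k isT)/eqP; rewrite sqrf_eq0.
Qed.

Lemma orthonormal_rows_rank (F : fieldType) (r n : nat) (V : 'M[F]_(r, n)) :
  V *m V^T = 1%:M -> \rank V = r.
Proof.
move=> VV; apply/eqP; rewrite eqn_leq rank_leq_row /=.
by rewrite -[X in (X <= _)%N](mxrank1 F) -VV mxrankM_maxl.
Qed.

(** Eigenvectors for nonzero eigenvalues lie in the row space of [H]. Both row spaces have dimension
    [r], so they coincide, and [V^T *m V], which fixes the rows of [V], fixes those of [H]. *)
Lemma gram_spectral (F : fieldType) (m n r : nat) (H : 'M[F]_(m, n))
    (V : 'M[F]_(r, n)) (d : 'rV[F]_r) :
  \rank H = r -> (forall i, d 0 i != 0) -> V *m V^T = 1%:M ->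
  H^T *m H *m V^T = V^T *m diag_mx d ->
  H^T *m H = V^T *m diag_mx d *m V.
Proof.
move=> rkH d0 VV AV.
have VA : diag_mx d *m V = V *m H^T *m H.
  apply: trmx_inj; rewrite trmx_mul tr_diag_mx -AV.
  by rewrite !trmx_mul trmxK mulmxA.
have dV : diag_mx (\row_i (d 0 i)^-1) *m diag_mx d = 1%:M.
  apply/matrixP => i j; rewrite mul_diag_mx !mxE.
  by case: eqVneq => [->|_]; rewrite ?mulr0n ?mulr0 // !mulr1n mulVf.
have VH : (V <= H)%MS.
  (* The witness is [VA] solved for [V] by inverting the diagonal matrix. *)
  apply/submxP; exists (diag_mx (\row_i (d 0 i)^-1) *m (V *m H^T)).
  by rewrite -mulmxA -VA mulmxA dV mul1mx.
have /submxP [M HM] : (H <= V)%MS.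
  by rewrite -(geq_leqif (mxrank_leqif_sup VH)) rkH orthonormal_rows_rank.
have HVV : H *m V^T *m V = H by rewrite HM -[M *m V *m _]mulmxA VV mulmx1.
by rewrite -AV -!mulmxA [H *m _]mulmxA HVV.
Qed.

Lemma rayleigh_max_eigen (R : rcfType) (n r : nat) (A : 'M[R]_n)
    (V : 'M[R]_(r, n)) (d : 'rV[R]_r) (l : R) (y : 'cV[R]_n) :
  V *m V^T = 1%:M -> A = V^T *m diag_mx d *m V ->
  0 <= l -> (forall i, d 0 i <= l) ->
  l * (y^T *m y) 0 0 <= (y^T *m A *m y) 0 0 -> A *m y = l *: y.
Proof.
move=> VV AE l0 dl hy.
pose Q := V^T *m V; pose e := \row_i Num.sqrt (l - d 0 i).
pose E := V^T *m diag_mx e *m V.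
(* [Q] is the orthogonal projection onto the row space of [V]. There [l - A] has eigenvalues
   [l - d 0 i]; on the complement [A] vanishes, leaving [l]. Taking roots on both pieces gives [B]
   with [B *m B = l%:M - A], so the hypothesis on [y] bounds the squared norm of [B *m y] by 0. *)
pose B := Num.sqrt l *: (1%:M - Q) + E.
have BT : B^T = B.
  rewrite /B /E /Q raddfD /= linearZ /= raddfB /= trmx1 !trmx_mul trmxK.
  by rewrite tr_diag_mx mulmxA.
have ee : diag_mx e *m diag_mx e = l%:M - diag_mx d.
  apply/matrixP => i j; rewrite mul_diag_mx !mxE.
  case: eqVneq => [->|_]; last by rewrite !mulr0n mulr0 subr0.
  by rewrite !mulr1n -expr2 sqr_sqrtr ?subr_ge0.
have QQ : Q *m Q = Q by rewrite /Q mulmxA -[_ *m V *m V^T]mulmxA VV mulmx1.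
have QE : Q *m E = E.
  by rewrite /Q /E !mulmxA -[_ *m V *m V^T]mulmxA VV mulmx1.
have EQ : E *m Q = E.
  by rewrite /Q /E !mulmxA -[_ *m V *m V^T]mulmxA VV mulmx1.
have EE : E *m E = l *: Q - A.
  rewrite {1}/E /E !mulmxA -[_ *m V *m V^T]mulmxA VV mulmx1.
  rewrite -[_ *m diag_mx e *m diag_mx e]mulmxA ee mulmxBr mulmxBl -AE.
  by rewrite mul_mx_scalar -scalemxAl.
have BB : B *m B = l%:M - A.
  rewrite /B mulmxDl !mulmxDr -!scalemxAl -!scalemxAr scalerA -expr2.
  rewrite sqr_sqrtr // !mulmxBl !mulmxBr !mul1mx !mulmx1 QQ QE EQ EE.
  by rewrite !subrr subr0 scaler0 addr0 add0r scalerBr addrA subrK scalemx1.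
have By : B *m y = 0.
  apply: trmx_mul_self_eq0.
  rewrite trmx_mul BT mulmxA -[_ *m B *m B]mulmxA BB mulmxBr mulmxBl.
  rewrite mul_mx_scalar -scalemxAl [leLHS]mxE [X in X + _]mxE.
  by rewrite [X in _ + X]mxE subr_le0.
apply/esym/eqP; rewrite -subr_eq0 -mul_scalar_mx -mulmxBl -BB -mulmxA By.
by rewrite mulmx0.
Qed.

Section Connected.

Variables (R : realType) (m n : nat) (H : 'M[R]_(m, n)).
Hypothesis H_ge0 : forall i j, 0 <= H i j.
Hypothesis H_conn : channel_strongly_connected H.

Let A := H^T *m H.

Lemma gram_ge0 i j : 0 <= A i j.
Proof. by rewrite mxE sumr_ge0 // => k _; rewrite mxE mulr_ge0. Qed.

(** Where [x] vanishes, so does [A *m x], a sum of nonnegative terms; hence no edge joins the zero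
    set of [x] to its complement, and a nonempty zero set would disconnect the graph. *)
Lemma nonneg_eigen_gt0 (l : R) (x : 'cV[R]_n) :
  A *m x = l *: x -> (forall k, 0 <= x k 0) ->
  (exists k, x k 0 != 0) -> forall k, 0 < x k 0.
Proof.
move=> Ax x0 [k0 xk0] k; rewrite lt_def x0 andbT.
apply/negP => /eqP xk; apply: H_conn.
exists [set j | x j 0 == 0]; split.
- by apply/set0Pn; exists k; rewrite inE xk.
- by apply/properP; split; [exact: subsetT | exists k0; rewrite ?inE].
apply/matrixP => a b.
have : enum_val a \in ~: [set j | x j 0 == 0] := enum_valP a.
have : enum_val b \in [set j | x j 0 == 0] := enum_valP b.
rewrite !inE => /eqP xb xa.
have /(congr1 (fun M : 'cV_n => M (enum_val b) 0)) := Ax.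
rewrite [LHS]mxE [RHS]mxE xb mulr0.
have t0 i : true -> 0 <= A (enum_val b) i * x i 0.
  by rewrite mulr_ge0 ?gram_ge0.
move/(psumr_eq0P t0)/(_ (enum_val a) isT)/eqP.
rewrite mulf_eq0 (negPf xa) orbF => /eqP Aba.
(* The block entry has the two indices of [Aba] swapped; [A] is symmetric. *)
rewrite [RHS]mxE; apply: etrans Aba; rewrite !mxE.
by apply: eq_bigr => i _; rewrite !mxE mulrC.
Qed.

Lemma top_eigen_sign (l : R) (u : 'cV[R]_n) :
  (forall y : 'cV[R]_n,
     l * (y^T *m y) 0 0 <= (y^T *m A *m y) 0 0 -> A *m y = l *: y) ->
  A *m u = l *: u -> u != 0 ->
  (forall k, 0 < u k 0) \/ (forall k, u k 0 < 0).
Proof.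
move=> top Au u0; pose x : 'cV[R]_n := \col_k `|u k 0|.
have quad (y : 'cV[R]_n) :
    (y^T *m A *m y) 0 0 = \sum_j \sum_i y i 0 * A i j * y j 0.
  rewrite mxE; apply: eq_bigr => j _; rewrite mxE mulr_suml.
  by apply: eq_bigr => i _; rewrite [y^T _ _]mxE.
have Ax : A *m x = l *: x.
  apply: top; have -> : (x^T *m x) 0 0 = (u^T *m u) 0 0.
    rewrite !mxE; apply: eq_bigr => k _.
    by rewrite !mxE -normrM ger0_norm // -expr2 sqr_ge0.
  have -> : l * (u^T *m u) 0 0 = (u^T *m A *m u) 0 0.
    by rewrite -mulmxA Au -scalemxAr [RHS]mxE.
  (* Since [A] is entrywise nonnegative, taking absolute values can only increase each term, while
     the norm is unchanged. *)
  rewrite !quad; apply: ler_sum => j _; apply: ler_sum => i _.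
  rewrite [x i 0]mxE [x j 0]mxE -[A i j](ger0_norm (gram_ge0 i j)) -!normrM.
  by rewrite ger0_norm ?gram_ge0 // ler_norm.
have x_gt0 : forall k, 0 < x k 0.
  apply: (nonneg_eigen_gt0 Ax) => [k|]; first by rewrite mxE.
  have [k uk] := cV0Pn _ u0.
  by exists k; rewrite mxE normr_eq0.
have Axu : A *m (x + u) = l *: (x + u) by rewrite mulmxDr Ax Au scalerDr.
have xu0 k : 0 <= (x + u) k 0 by rewrite !mxE -lerBlDr sub0r -normrN ler_norm.
(* Either [u] is the negative of the positive vector [x], or [x + u] is positive everywhere; the
   latter excludes [u k 0 <= 0], where the entry of [x + u] is 0. *)
have [xu|/cV0Pn xu] := eqVneq (x + u) 0.
  right=> k; have := x_gt0 k; have /colP/(_ k) := xu.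
  by rewrite !mxE => /eqP; rewrite addr_eq0 => /eqP ->; rewrite oppr_gt0.
left=> k; have := nonneg_eigen_gt0 Axu xu0 xu k.
by rewrite !mxE; case: (ltrgt0P (u k 0)) => [||->]; rewrite ?addNr ?addr0 ?ltxx.
Qed.

End Connected.

(** Up to signs, the inner product is a sum of positive terms; [u != 0] supplies an index, ruling
    out the empty sum. *)
Lemma const_sign_not_orthogonal (R : realDomainType) (n : nat)
    (u w : 'cV[R]_n) :
  u != 0 ->
  (forall k, 0 < u k 0) \/ (forall k, u k 0 < 0) ->
  (forall k, 0 < w k 0) \/ (forall k, w k 0 < 0) ->
  (u^T *m w) 0 0 != 0.
Proof.
move=> /cV0Pn [k0 _] su sw.
have pos (a b : 'cV[R]_n) : (forall k, 0 < a k 0) -> (forall k, 0 < b k 0) ->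
    (a^T *m b) 0 0 != 0.
  move=> a0 b0; rewrite mxE; apply/eqP.
  have t0 k : true -> 0 <= a^T 0 k * b k 0 by rewrite mxE mulr_ge0 // ltW.
  move/(psumr_eq0P t0)/(_ k0 isT)/eqP.
  by rewrite mxE mulf_eq0 (gt_eqF (a0 k0)) (gt_eqF (b0 k0)).
have negate (a : 'cV[R]_n) : (forall k, a k 0 < 0) -> forall k, 0 < (- a) k 0.
  by move=> a0 k; rewrite mxE oppr_gt0.
have oppE (M : 'M[R]_1) : ((- M) 0 0 != 0) = (M 0 0 != 0).
  by rewrite mxE oppr_eq0.
case: su sw => [su|/negate su] [sw|/negate sw]; have := pos _ _ su sw => //.
- by rewrite mulmxN oppE.
- by rewrite [(- u)^T]linearN /= mulNmx oppE.
- by rewrite [(- u)^T]linearN /= mulNmx mulmxN opprK.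
Qed.

Theorem theorem1 (R : realType) (nR nT r : nat) (H : 'M[R]_(nR, nT))
    (sigma : 'I_r -> R) (v : 'I_r -> 'cV[R]_nT)
    (H_ge0 : forall i j, 0 <= H i j)
    (rankH : \rank H = r) (r_gt0 : (0 < r)%N)
    (sigmaH : nonzero_singular_values H sigma)
    (v_orthonormal : forall i j, (v i)^T *m v j = (i == j)%:R%:M)
    (v_eigen : forall i, H^T *m H *m v i = sigma i ^+ 2 *: v i)
    (H_connected : channel_strongly_connected H) :
  ((forall k, 0 < v (Ordinal r_gt0) k 0) \/
   (forall k, v (Ordinal r_gt0) k 0 < 0)) /\
  (forall i : 'I_r, (0 < i)%N -> sigma i < sigma (Ordinal r_gt0)).
Proof.
case: sigmaH => s_gt0 s_mono _.
set o := Ordinal r_gt0.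
pose V : 'M[R]_(r, nT) := \matrix_(i, k) v i k 0.
pose d : 'rV[R]_r := \row_i sigma i ^+ 2.
have VV : V *m V^T = 1%:M.
  apply/matrixP => i j.
  have /(congr1 (fun M : 'M_1 => M 0 0)) := v_orthonormal i j.
  rewrite !mxE eqxx mulr1n => <-.
  by apply: eq_bigr => k _; rewrite !mxE.
have AV : H^T *m H *m V^T = V^T *m diag_mx d.
  apply/matrixP => k i.
  have /(congr1 (fun M : 'cV_nT => M k 0)) := v_eigen i.
  rewrite [X in _ = X -> _]mxE => E.
  rewrite mul_mx_diag [RHS]mxE [V^T _ _]mxE [V _ _]mxE [d _ _]mxE mulrC -E.
  by rewrite !mxE; apply: eq_bigr => j _; rewrite [V^T _ _]mxE [V _ _]mxE.
have d0 i : d 0 i != 0 by rewrite mxE expf_neq0 // gt_eqF.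
have AE := gram_spectral rankH d0 VV AV.
have dl i : d 0 i <= sigma o ^+ 2.
  by rewrite mxE ler_pXn2r ?nnegrE ?(ltW (s_gt0 _)) // s_mono.
have top (y : 'cV[R]_nT) := rayleigh_max_eigen (y := y) VV AE (sqr_ge0 _) dl.
have v0 i : v i != 0.
  apply/eqP => vi; have := v_orthonormal i i.
  rewrite vi mulmx0 eqxx => /matrixP /(_ 0 0) /eqP.
  by rewrite !mxE eqxx eq_sym oner_eq0.
(* Stated for every index attaining the top singular value, so that it also covers a hypothetical
   second one, whose vector would have to be orthogonal to [v o]. *)
have sgn i : sigma i = sigma o ->
    (forall k, 0 < v i k 0) \/ (forall k, v i k 0 < 0).
  by move=> si; apply: top_eigen_sign top _ (v0 i); rewrite // v_eigen si.
split; first exact: sgn.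
move=> i i0; rewrite lt_neqAle s_mono // andbT; apply/eqP => si.
have := const_sign_not_orthogonal (v0 i) (sgn _ si) (sgn _ erefl).
have io : i != o by rewrite -val_eqE /= -lt0n.
by rewrite v_orthonormal (negPf io) mxE mul0rn eqxx.
Qed.
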